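(* Let $A,B,C\in\mathbb{C}^{N\times N}$ be commutative (pairwise commuting) matrices such that $B+sI$ and $C+sI$ are invertible for every integer $s\ge 0$. Then the entire function ${}_1F_2(A;B,C;z)=\sum_{s=0}^{\infty}z^sU_s$, with $U_s=\frac{1}{s!}(A)_s[(B)_s]^{-1}[(C)_s]^{-1}$, has type $\tau=2$.
   Context: $I$ is the $N\times N$ identity matrix. For $M\in\mathbb{C}^{N\times N}$, $(M)_0=I$ and $(M)_s=M(M+I)\cdots(M+(s-1)I)$ for $s\ge1$. $\|\cdot\|$ is the operator 2-norm. For an entire function $f(z)=\sum_{s\ge0}z^sU_s$ with matrix coefficients, the order $\rho$ and type $\tau$ are $$\rho=\limsup_{s\to\infty}\frac{s\ln s}{\ln\left(1/\|U_s\|\right)},\qquad \tau=\frac{1}{e\rho}\limsup_{s\to\infty}s\,\|U_s\|^{\rho/s}.$$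
   Formalization: The formal theorem also assumes (A)_s ≠ 0 for every s (which implies N ≥ 1); otherwise the series is a polynomial (e.g. A = 0 or A = -kI), its order by the given formula is 0, and the type formula divides by zero. *)

(* Defs.v *)
From HB Require Import structures.
From mathcomp Require Import all_boot all_order all_algebra.
From mathcomp Require Import all_classical all_reals all_analysis.
From mathcomp Require Import complex.
Set Implicit Arguments.
Unset Strict Implicit.
Unset Printing Implicit Defensive.
Import Order.TTheory GRing.Theory Num.Theory.
Import numFieldNormedType.Exports.
Local Open Scope classical_set_scope.
Local Open Scope ring_scope.
Local Open Scope complex_scope.

(* mathcomp-analysis puts its topology on [R[i]^o], not on [R[i]] itself.     *)
Notation Cmx R N := 'M[(R[i]^o)%type]_N (only parsing).

Section MatrixSeries.
Context {R : realType} {N : nat}.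
Implicit Types (M : 'M[R[i]]_N) (U : nat -> 'M[R[i]]_N).

Definition pochmx M (s : nat) : 'M[R[i]]_N :=
  \prod_(k < s) (M + k%:R%:M).

Definition norm2 (x : 'cV[R[i]]_N) : R :=
  Num.sqrt (\sum_(i < N) (complex.Re (x i 0) ^+ 2 + complex.Im (x i 0) ^+ 2)).

Definition opnorm2 M : R :=
  sup [set norm2 (M *m x) | x in [set x : 'cV[R[i]]_N | norm2 x <= 1]].

Definition mxpowser U (z : R[i]) : nat -> Cmx R N :=
  series (fun s => z ^+ s *: U s : Cmx R N).

(* The power series with coefficients [U] converges to [f] on the whole plane. *)
Definition entire_expansion (f : R[i] -> 'M[R[i]]_N) U : Prop :=
  forall z, mxpowser U z @ \oo --> (f z : Cmx R N).

(* A vanishing [U s] contributes 0, as it should since ln (1 / 0) = +oo:      *)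
(* here 0^-1 = 0, ln 0 = 0 and x / 0 = 0.                                     *)
Definition entire_order U : \bar R :=
  limn_esup (fun s => (s%:R * ln s%:R / ln (opnorm2 (U s))^-1)%:E).

(* The formula for the type only makes sense when the order is a positive     *)
(* real number; otherwise [U] has no type.                                    *)
Definition has_entire_type U (tau : \bar R) : Prop :=
  exists rho : R, [/\ entire_order U = rho%:E, 0 < rho &
    tau = ((expR 1 * rho)^-1%:E *
           limn_esup (fun s => (s%:R * opnorm2 (U s) `^ (rho / s%:R))%:E))%E].

Definition coef1F2 (A B C : 'M[R[i]]_N) (s : nat) : 'M[R[i]]_N :=
  (s`!%:R)^-1 *: (pochmx A s *m invmx (pochmx B s) *m invmx (pochmx C s)).

Definition hyp1F2 (A B C : 'M[R[i]]_N) (z : R[i]) : 'M[R[i]]_N :=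
  limn (mxpowser (coef1F2 A B C) z).

End MatrixSeries.

(* Main.v *)
Require Import Defs.
From HB Require Import structures.
From mathcomp Require Import all_boot all_order all_algebra.
From mathcomp Require Import all_classical all_reals all_analysis.
From mathcomp Require Import complex ring lra.
Import Order.TTheory GRing.Theory Num.Theory.
Import numFieldNormedType.Exports.
Local Open Scope classical_set_scope.
Local Open Scope ring_scope.
Local Open Scope complex_scope.

(** Up to a factor growing slower than any exponential, the Pochhammer matrix
(M)_s has norm s!, and its inverse, when it exists, has norm 1 / s!.  Hence the
s-th coefficient U_s has norm (1 / s!) * s! * (1 / s!) * (1 / s!), that is
1 / s! ^ 2, up to such a factor, and by Stirling's formula

      ln ||U_s|| / s + 2 * ln s  -->  2.                                (1)

Everything follows from (1).  Dividing by ln s shows that the order is 1/2;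
taking the exponential of half of (1) gives s * ||U_s|| ^ (1 / (2 * s)) --> e,
so that the type is e / (e * 1/2) = 2; and (1) makes ||U_s|| smaller than any
geometric sequence, so that the power series converges on the whole plane.
The three deductions are [cvg_order], [cvg_type] and [is_cvg_series_growth].

To reach (1) without Gamma functions, the norm of a product of s factors is
compared with s! through logarithms: if each factor l_k satisfies
l_k / (k + 1) --> 1, then ln (\prod_(k < s) l_k) - ln s! = o(s), by Cesaro's
theorem ([cvg_ln_prod]).  The factors come from the operator norm: M + k has
norm at most k + ||M||, and for k > ||M|| its inverse has norm at most
1 / (k - ||M||).  The first bound controls (M)_s from above.  The second one
controls (M)_s^-1 from above, and (M)_s from below, since (M)_m is recovered
from (M)_s by multiplying by the inverses of the factors of index at least m;
this gives a positive lower bound because (M)_m != 0, even though the first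
factors of (M)_m may be singular.  Finally U_s is bounded below by solving its
definition for (A)_s = s! * U_s * (C)_s * (B)_s ([cvg_ln_opnorm2_coef1F2]). *)

(** * Logarithmic asymptotics of real sequences *)

Section ScalarAsymptotics.
Set Implicit Arguments.
Unset Strict Implicit.
Variable R : realType.
Implicit Types (l u : nat -> R).

(** The domain nat and the filter are fixed so that this limit can be combined
with others by forward reasoning. *)
Lemma cvgn_cst (c : R) : (fun _ : nat => c) @ \oo --> c.
Proof. exact: cvg_cst. Qed.

Lemma cvg_mean u (a : R) : u @ \oo --> a ->
  (fun s => (\sum_(k < s) u k) / s%:R) @ \oo --> a.
Proof.
move=> /cesaro; rewrite -(cvg_shiftS (fun s => (\sum_(k < s) u k) / s%:R)).
apply: cvg_trans; apply: near_eq_cvg; near=> n.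
by rewrite /arithmetic_mean/= /series/= big_mkord mulrC.
Unshelve. all: by end_near. Qed.

Lemma cvg_cst_div (c : R) : (fun s => c / s%:R) @ \oo --> (0 : R).
Proof.
rewrite -(cvg_shiftS (fun s => c / s%:R)).
by have := cvgM (@cvgn_cst c) (@cvg_harmonic R); rewrite mulr0; exact.
Qed.

Lemma cvg_lnn_pinfty : (fun s => ln s%:R : R) @ \oo --> +oo.
Proof.
apply/cvgryPge => M; near=> s.
rewrite -[M]expRK ler_ln ?posrE ?expR_gt0//.
  by near: s; exact: nbhs_infty_ger.
by near: s; exact: nbhs_infty_gtr.
Unshelve. all: by end_near. Qed.

(** Both bounds are ln (1 + x) <= x: at x = 1 / k for the upper one, and at
x = - 1 / (k + 1) for the lower one, as 1 + 1 / k = (1 - 1 / (k + 1))^-1. *)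
Lemma cvg_nat_ln1D : (fun k => k%:R * ln (1 + k%:R^-1) : R) @ \oo --> (1 : R).
Proof.
have h1 : (fun k => 1 - k.+1%:R^-1 : R) @ \oo --> (1 : R).
  rewrite -[X in _ --> X]subr0; apply: cvgB; first exact: cvg_cst.
  exact: cvg_harmonic.
apply: (squeeze_cvgr _ h1 (@cvgn_cst 1)); near=> k.
have k0 : 0 < k%:R :> R by near: k; exact: nbhs_infty_gtr.
have k10 : 0 < k.+1%:R :> R by rewrite ltr0n.
have kS : k.+1%:R = k%:R + 1 :> R by rewrite -natr1.
apply/andP; split; last first.
  rewrite -ler_pdivlMl// mulr1; apply: le_ln1Dx.
  by rewrite (lt_trans (ltrN10 _))// invr_gt0.
have -> : 1 - k.+1%:R^-1 = k%:R * k.+1%:R^-1 :> R.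
  by rewrite kS; field; rewrite -kS gt_eqF.
rewrite ler_pM2l//.
have -> : 1 + k%:R^-1 = (1 + - k.+1%:R^-1)^-1 :> R.
  by rewrite kS; field; rewrite -kS !gt_eqF//=; lra.
have k11 : k.+1%:R^-1 < 1 :> R by rewrite invf_lt1// kS; lra.
rewrite lnV ?posrE; last by rewrite subr_gt0.
by rewrite lerNr le_ln1Dx// ltrN2.
Unshelve. all: by end_near. Qed.

(** The leading order of Stirling's formula.  The sequence
a_s = ln s! - s * ln s has increments - k * ln (1 + 1 / k), which tend to -1;
so do their means a_s / s. *)
Lemma cvg_ln_fact :
  (fun s => ln s`!%:R / s%:R - ln s%:R : R) @ \oo --> (-1 : R).
Proof.
pose a s : R := ln s`!%:R - s%:R * ln s%:R.
have aS k : (0 < k)%N -> a k.+1 - a k = - (k%:R * ln (1 + k%:R^-1)).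
  move=> k0; have k0' : 0 < k%:R :> R by rewrite ltr0n.
  have -> : 1 + k%:R^-1 = k.+1%:R / k%:R :> R.
    by rewrite -natr1; field; rewrite gt_eqF.
  rewrite /a factS natrM lnM ?posrE ?ltr0n ?fact_gt0//.
  rewrite ln_div ?posrE ?ltr0n//.
  by move: (ln k.+1%:R) => L; rewrite -natr1; ring.
have da : (fun k => a k.+1 - a k) @ \oo --> (-1 : R).
  apply: cvg_trans (cvgN cvg_nat_ln1D); apply: near_eq_cvg; near=> k.
  by rewrite aS//; near: k; exact: nbhs_infty_gt.
apply: cvg_trans (cvg_mean da); apply: near_eq_cvg; near=> s.
have s0 : 0 < s%:R :> R by near: s; exact: nbhs_infty_gtr.
rewrite -(big_mkord xpredT (fun k => a k.+1 - a k)) telescope_sumr//.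
by rewrite /a fact0 mul0r ln1 !subr0 mulrBl mulrAC divff ?gt_eqF// mul1r.
Unshelve. all: by end_near. Qed.

(** The left-hand side is the mean of the ln (l_k / (k + 1)), which tend to
ln 1 = 0. *)
Lemma cvg_ln_prod l : (forall k, 0 < l k) ->
  (fun k => l k / k.+1%:R) @ \oo --> (1 : R) ->
  (fun s => (ln (\prod_(k < s) l k) - ln s`!%:R) / s%:R) @ \oo --> (0 : R).
Proof.
move=> l0 l1.
have : (fun k => ln (l k / k.+1%:R)) @ \oo --> (0 : R).
  by rewrite -ln1; apply: continuous_cvg => //; exact: continuous_ln.
move=> /cvg_mean; apply: cvg_trans; apply: near_eq_cvg; near=> s.
congr (_ / _); elim: {+}s => [|n IH]; first by rewrite !big_ord0 fact0 subrr.
rewrite !big_ord_recr/= IH factS natrM.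
rewrite ln_div ?posrE ?ltr0n//.
rewrite lnM ?posrE ?prodr_gt0// lnM ?posrE ?ltr0n ?fact_gt0//; ring.
Unshelve. all: by end_near. Qed.

(** The real-number half of the growth of U_s, where u, a, b, c, b', c' stand
for the logarithms of the norms of U_s, (A)_s, (B)_s, (C)_s, (B)_s^-1 and
(C)_s^-1.  Both bounds on u are - 2 * ln s! + o(s), and
- 2 * ln s! = - 2 * s * ln s + 2 * s + o(s). *)
Lemma cvg_growth_squeeze (u a b c b' c' : nat -> R) :
  (fun s => (a s - ln s`!%:R) / s%:R) @ \oo --> (0 : R) ->
  (fun s => (b s - ln s`!%:R) / s%:R) @ \oo --> (0 : R) ->
  (fun s => (c s - ln s`!%:R) / s%:R) @ \oo --> (0 : R) ->
  (fun s => (b' s + ln s`!%:R) / s%:R) @ \oo --> (0 : R) ->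
  (fun s => (c' s + ln s`!%:R) / s%:R) @ \oo --> (0 : R) ->
  (forall s, a s <= ln s`!%:R + (u s + c s + b s)) ->
  (forall s, u s <= - ln s`!%:R + (a s + b' s + c' s)) ->
  (fun s => u s / s%:R + 2 * ln s%:R) @ \oo --> (2 : R).
Proof.
move=> ga gb gc gb' gc' au ua.
pose proof (cvgM (@cvgn_cst 2) cvg_ln_fact) as gf.
have lb : (fun s => (a s - ln s`!%:R) / s%:R - (b s - ln s`!%:R) / s%:R
    - (c s - ln s`!%:R) / s%:R - 2 * (ln s`!%:R / s%:R - ln s%:R)) @ \oo
    --> (2 : R).
  have := cvgB (cvgB (cvgB ga gb) gc) gf.
  by rewrite !subr0 sub0r mulrN1 opprK; exact.
have ub : (fun s => (a s - ln s`!%:R) / s%:R + (b' s + ln s`!%:R) / s%:R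
    + (c' s + ln s`!%:R) / s%:R - 2 * (ln s`!%:R / s%:R - ln s%:R)) @ \oo
    --> (2 : R).
  have := cvgB (cvgD (cvgD ga gb') gc') gf.
  by rewrite !addr0 sub0r mulrN1 opprK; exact.
apply: (squeeze_cvgr _ lb ub); near=> s.
have s0 : 0 < s%:R :> R by near: s; exact: nbhs_infty_gtr.
have := au s; have := ua s.
move: (u s) (a s) (b s) (c s) (b' s) (c' s) (ln s`!%:R) (ln s%:R).
move=> U A B C B' C' f t hU hA; apply/andP; split; rewrite -subr_ge0.
  have -> : U / s%:R + 2 * t - ((A - f) / s%:R - (B - f) / s%:R
      - (C - f) / s%:R - 2 * (f / s%:R - t)) = (f + (U + C + B) - A) / s%:R.
    by field; rewrite gt_eqF.
  by rewrite divr_ge0 ?subr_ge0// ltW.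
have -> : (A - f) / s%:R + (B' + f) / s%:R + (C' + f) / s%:R
    - 2 * (f / s%:R - t) - (U / s%:R + 2 * t)
    = (- f + (A + B' + C') - U) / s%:R.
  by field; rewrite gt_eqF.
by rewrite divr_ge0 ?subr_ge0// ltW.
Unshelve. all: by end_near. Qed.

End ScalarAsymptotics.

(** * The operator norm on complex matrices *)

Section OperatorNorm.
Set Implicit Arguments.
Unset Strict Implicit.
Variable R : realType.
Local Notation normc := (@Normc.normc R).

Lemma normc_ge0 (a : R[i]) : 0 <= normc a.
Proof. by case: a => a b; exact: sqrtr_ge0. Qed.

Lemma sqr_normc_ReIm (a : R[i]) :
  complex.Re a ^+ 2 + complex.Im a ^+ 2 = normc a ^+ 2.
Proof. by case: a => a b /=; rewrite sqr_sqrtr// addr_ge0// sqr_ge0. Qed.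

Lemma normc_real (r : R) : 0 <= r -> normc r%:C = r.
Proof. by move=> r0; rewrite /= expr0n/= addr0 sqrtr_sqr ger0_norm. Qed.

Lemma normc_nat (n : nat) : normc n%:R = n%:R.
Proof. by rewrite -(rmorph_nat (real_complex R)) normc_real. Qed.

Lemma normcX (z : R[i]) n : normc (z ^+ n) = normc z ^+ n.
Proof.
elim: n => [|n IH]; first by rewrite !expr0 Normc.normc1.
by rewrite !exprS Normc.normcM IH.
Qed.

(** The sum of the squares of the f i - t * g i is nonnegative; take the value
t = S / G that minimizes it. *)
Lemma Cauchy_Schwarz_sum (I : finType) (f g : I -> R) :
  (\sum_i f i * g i) ^+ 2 <= (\sum_i f i ^+ 2) * (\sum_i g i ^+ 2).
Proof.
set S := \sum_i _ * _; set F := \sum_i f i ^+ 2; set G := \sum_i g i ^+ 2.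
have G0 : 0 <= G by apply: sumr_ge0 => i _; exact: sqr_ge0.
have [G_eq0|G_neq0] := eqVneq G 0.
  have g0 i : g i = 0.
    have /eqP := G_eq0; rewrite psumr_eq0; last by move=> j _; exact: sqr_ge0.
    by move=> /allP/(_ i (mem_index_enum _)); rewrite sqrf_eq0 => /eqP.
  by rewrite /S big1 ?expr0n/= ?G_eq0 ?mulr0// => i _; rewrite g0 mulr0.
have {G_neq0}G_gt0 : 0 < G by rewrite lt_def G_neq0.
have : 0 <= \sum_i (f i - S / G * g i) ^+ 2.
  by apply: sumr_ge0 => i _; exact: sqr_ge0.
rewrite (eq_bigr (fun i => f i ^+ 2 + (- (2 * (S / G))) * (f i * g i)
   + (S / G) ^+ 2 * g i ^+ 2)); last by move=> i _; ring.
rewrite !big_split/= -!mulr_sumr -/S -/F -/G.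
have -> : F + - (2 * (S / G)) * S + (S / G) ^+ 2 * G = F - S ^+ 2 / G.
  by field; rewrite gt_eqF.
by rewrite subr_ge0 ler_pdivrMr.
Qed.

Section Norm2.
Variable N : nat.
Implicit Types (x y : 'cV[R[i]]_N).

Lemma norm2E x : norm2 x = Num.sqrt (\sum_(i < N) normc (x i 0) ^+ 2).
Proof. by congr Num.sqrt; apply: eq_bigr => i _; exact: sqr_normc_ReIm. Qed.

Lemma norm2_ge0 x : 0 <= norm2 x.
Proof. exact: sqrtr_ge0. Qed.

Lemma sqr_norm2 x : norm2 x ^+ 2 = \sum_(i < N) normc (x i 0) ^+ 2.
Proof.
by rewrite norm2E sqr_sqrtr//; apply: sumr_ge0 => i _; exact: sqr_ge0.
Qed.

Lemma normc_le_norm2 x i : normc (x i 0) <= norm2 x.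
Proof.
rewrite -(ler_pXn2r (_ : (0 < 2)%N)) ?nnegrE ?normc_ge0 ?norm2_ge0//.
rewrite sqr_norm2 (bigD1 i)//= lerDl.
by apply: sumr_ge0 => j _; exact: sqr_ge0.
Qed.

Lemma norm2_eq0 x : norm2 x = 0 -> x = 0.
Proof.
move=> x0; apply/matrixP => i j; rewrite ord1 mxE.
apply: Normc.eq0_normc; apply/eqP; rewrite eq_le normc_ge0 andbT -x0.
exact: normc_le_norm2.
Qed.

Lemma norm20 : norm2 (0 : 'cV[R[i]]_N) = 0.
Proof.
by rewrite norm2E big1 ?sqrtr0// => i _; rewrite mxE Normc.normc0 expr0n.
Qed.

Lemma norm2Z (a : R[i]) x : norm2 (a *: x) = normc a * norm2 x.
Proof.
apply/eqP; rewrite -(eqrXn2 (_ : (0 < 2)%N)) ?mulr_ge0 ?norm2_ge0 ?normc_ge0//.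
rewrite exprMn !sqr_norm2 mulr_sumr; apply/eqP/eq_bigr => i _.
by rewrite mxE Normc.normcM exprMn.
Qed.

Lemma norm2D x y : norm2 (x + y) <= norm2 x + norm2 y.
Proof.
rewrite -(ler_pXn2r (_ : (0 < 2)%N)) ?nnegrE ?addr_ge0 ?norm2_ge0//.
rewrite sqr_norm2.
have: \sum_(i < N) normc (x i 0) * normc (y i 0) <= norm2 x * norm2 y.
  rewrite -(ler_pXn2r (_ : (0 < 2)%N)) ?nnegrE ?mulr_ge0 ?norm2_ge0//.
    by rewrite exprMn !sqr_norm2; exact: Cauchy_Schwarz_sum.
  by apply: sumr_ge0 => i _; rewrite mulr_ge0 ?normc_ge0.
move=> CS; apply: (@le_trans _ _
    (\sum_(i < N) (normc (x i 0) + normc (y i 0)) ^+ 2)).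
  apply: ler_sum => i _; rewrite mxE ler_pXn2r ?nnegrE ?addr_ge0 ?normc_ge0//.
  exact: le_normcD.
under eq_bigr do rewrite sqrrD.
rewrite !big_split/= -!sqr_norm2 sqrrD lerD2r lerD2l.
by rewrite mulr2n lerD.
Qed.

Lemma norm2_sum (I : finType) (F : I -> 'cV[R[i]]_N) :
  norm2 (\sum_i F i) <= \sum_i norm2 (F i).
Proof.
elim/big_ind2: _ => [|u a v b ua vb|//]; first by rewrite norm20.
by apply: le_trans (norm2D _ _) _; exact: lerD.
Qed.

End Norm2.

Section OpNorm.
Variable N : nat.
Implicit Types (x y : 'cV[R[i]]_N) (M P : 'M[R[i]]_N).

Lemma opnorm2_le M (c : R) :
  0 <= c -> (forall x, norm2 (M *m x) <= c * norm2 x) -> opnorm2 M <= c.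
Proof.
move=> c0 Mc; apply: ge_sup.
  by exists (norm2 (M *m 0)), 0 => //=; rewrite norm20.
by move=> _ [x /= x1 <-]; rewrite (le_trans (Mc x))// ler_piMr.
Qed.

(** The supremum that defines the operator norm is over a bounded set: on the
unit ball, each coordinate of x is at most 1, so the sum of the norms of the
columns of M is a bound. *)
Lemma norm2_mulmx_ball M x : norm2 x <= 1 -> norm2 (M *m x) <= opnorm2 M.
Proof.
move=> x1; apply: ub_le_sup; last by exists x.
exists (\sum_j norm2 (col j M)) => _ [z /= z1 <-].
have -> : M *m z = \sum_j z j 0 *: col j M.
  apply/matrixP => i k; rewrite ord1 mxE summxE; apply: eq_bigr => j _.
  by rewrite !mxE mulrC.
apply: (le_trans (norm2_sum _)); apply: ler_sum => j _.
by rewrite norm2Z ler_piMl ?norm2_ge0// (le_trans (normc_le_norm2 _ _)).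
Qed.

Lemma opnorm2_ge0 M : 0 <= opnorm2 M.
Proof.
by rewrite -(norm20 N) -[0 in X in X <= _](mulmx0 _ M) norm2_mulmx_ball ?norm20.
Qed.

Lemma norm2_mulmx_le M x : norm2 (M *m x) <= opnorm2 M * norm2 x.
Proof.
have [x0|x0] := eqVneq (norm2 x) 0.
  by rewrite x0 (norm2_eq0 x0) mulmx0 norm20 mulr0.
have x_gt0 : 0 < norm2 x by rewrite lt_def x0 norm2_ge0.
rewrite -ler_pdivrMr// mulrC.
have xV0 : 0 <= (norm2 x)^-1 by rewrite invr_ge0 ltW.
rewrite -[X in X * _](normc_real xV0) -norm2Z scalemxAr.
by apply: norm2_mulmx_ball; rewrite norm2Z normc_real// mulVf.
Qed.

Lemma normc_le_opnorm2 M i j : normc (M i j) <= opnorm2 M.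
Proof.
have e1 : norm2 (delta_mx j 0 : 'cV[R[i]]_N) <= 1.
  rewrite norm2E (bigD1 j)//= big1 => [|k kj]; last first.
    by rewrite mxE (negPf kj) mulr0n Normc.normc0 expr0n.
  by rewrite mxE !eqxx mulr1n Normc.normc1 expr1n addr0 sqrtr1.
apply: le_trans (norm2_mulmx_ball M e1).
by rewrite -colE; apply: le_trans (normc_le_norm2 _ i); rewrite mxE.
Qed.

Lemma opnorm2_gt0 M : M != 0 -> 0 < opnorm2 M.
Proof.
move=> M0; rewrite lt_def opnorm2_ge0 andbT; apply: contra M0 => /eqP M0.
apply/eqP/matrixP => i j; rewrite mxE; apply: Normc.eq0_normc.
by apply/eqP; rewrite eq_le normc_ge0 andbT -M0 normc_le_opnorm2.
Qed.

Lemma opnorm2M M P : opnorm2 (M *m P) <= opnorm2 M * opnorm2 P.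
Proof.
apply: opnorm2_le => [|x]; first by rewrite mulr_ge0 ?opnorm2_ge0.
rewrite -mulmxA (le_trans (norm2_mulmx_le _ _))// -mulrA.
by rewrite ler_wpM2l ?opnorm2_ge0// norm2_mulmx_le.
Qed.

Lemma opnorm2Z (a : R[i]) M : opnorm2 (a *: M) <= normc a * opnorm2 M.
Proof.
apply: opnorm2_le => [|x]; first by rewrite mulr_ge0 ?normc_ge0 ?opnorm2_ge0.
by rewrite -scalemxAl norm2Z -mulrA ler_wpM2l ?normc_ge0// norm2_mulmx_le.
Qed.

Lemma opnorm2_1 : opnorm2 (1%:M : 'M[R[i]]_N) <= 1.
Proof. by apply: opnorm2_le => // x; rewrite mul1mx mul1r. Qed.

Lemma opnorm2_shift M (k : nat) : opnorm2 (M + k%:R%:M) <= opnorm2 M + k%:R.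
Proof.
apply: opnorm2_le => [|x]; first by rewrite addr_ge0 ?opnorm2_ge0.
rewrite mulmxDl mul_scalar_mx mulrDl (le_trans (norm2D _ _))//.
by rewrite norm2Z normc_nat lerD2r norm2_mulmx_le.
Qed.

(** The triangle inequality for k x = (M + k) x - M x. *)
Lemma shift_mulmx_ge M (k : nat) x :
  (k%:R - opnorm2 M) * norm2 x <= norm2 ((M + k%:R%:M) *m x).
Proof.
rewrite mulrBl lerBlDr -normc_nat -norm2Z.
have -> : k%:R *: x = (M + k%:R%:M) *m x + (- 1) *: (M *m x).
  by rewrite mulmxDl mul_scalar_mx scaleN1r addrAC subrr add0r.
rewrite (le_trans (norm2D _ _))// lerD2l norm2Z.
have -> : normc (- 1) = 1.
  by rewrite /= oppr0 expr0n/= addr0 sqrrN sqrtr_sqr normr1.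
by rewrite mul1r norm2_mulmx_le.
Qed.

(** By the previous bound M + k kills no nonzero vector. *)
Lemma shift_unitmx M (k : nat) : opnorm2 M < k%:R -> M + k%:R%:M \in unitmx.
Proof.
move=> Mk; rewrite -unitmx_tr -row_free_unit -kermx_eq0.
apply/eqP/row_matrixP => i.
rewrite row0; apply: trmx_inj; rewrite trmx0.
apply: norm2_eq0; apply/eqP; rewrite eq_le norm2_ge0 andbT.
rewrite -(pmulr_rle0 _ (_ : 0 < k%:R - opnorm2 M)) ?subr_gt0//.
apply: le_trans (shift_mulmx_ge _ _ _) _; set P := _ + _.
by rewrite -{1}[P]trmxK -trmx_mul -row_mul mulmx_ker row0 trmx0 norm20.
Qed.

Lemma opnorm2_inv_shift M (k : nat) : opnorm2 M < k%:R ->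
  opnorm2 (invmx (M + k%:R%:M)) <= (k%:R - opnorm2 M)^-1.
Proof.
move=> Mk; have kM : 0 < k%:R - opnorm2 M by rewrite subr_gt0.
apply: opnorm2_le => [|x]; first by rewrite invr_ge0 ltW.
rewrite ler_pdivlMl// (le_trans (shift_mulmx_ge _ _ _))//.
by rewrite mulmxA mulmxV ?mul1mx// shift_unitmx.
Qed.

End OpNorm.
End OperatorNorm.

(** * Growth of the Pochhammer matrices *)

Section PochhammerGrowth.
Set Implicit Arguments.
Unset Strict Implicit.
Variables (R : realType) (N : nat).
Implicit Types M : 'M[R[i]]_N.

Lemma pochmxS M s : pochmx M s.+1 = pochmx M s *m (M + s%:R%:M).
Proof. by rewrite /pochmx big_ord_recr. Qed.

Lemma pochmx_unitmx M s :
  (forall k, M + k%:R%:M \in unitmx) -> pochmx M s \in unitmx.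
Proof.
move=> Mu; elim: s => [|s IH]; first by rewrite /pochmx big_ord0 unitmx1.
by rewrite pochmxS unitmx_mul IH Mu.
Qed.

Lemma invmx_pochmxS M s : (forall k, M + k%:R%:M \in unitmx) ->
  invmx (pochmx M s.+1) = invmx (M + s%:R%:M) *m invmx (pochmx M s).
Proof.
move=> Mu; rewrite -[RHS](mulKmx (pochmx_unitmx s.+1 Mu)) !pochmxS.
by rewrite -!mulmxA mulKVmx// mulmxV ?mulmx1 ?pochmx_unitmx.
Qed.

(** The summand 1 keeps the bound positive for k = 0 and M = 0, so that its
logarithm behaves. *)
Definition poch_ub M (k : nat) : R := k%:R + (opnorm2 M + 1).

(** Only the large values of k matter; the maximum with 1 makes all the factors
positive. *)
Definition poch_lb M (k : nat) : R := Num.max 1 (k%:R - opnorm2 M).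

Lemma poch_ub_gt0 M k : 0 < poch_ub M k.
Proof. by rewrite /poch_ub addrA ltr_pwDr// addr_ge0 ?ler0n ?opnorm2_ge0. Qed.

Lemma poch_lb_gt0 M k : 0 < poch_lb M k.
Proof. by rewrite lt_max ltr01. Qed.

Lemma prod_poch_lb_gt0 M s : 0 < \prod_(k < s) poch_lb M k.
Proof. by apply: prodr_gt0 => k _; exact: poch_lb_gt0. Qed.

Lemma cvg_shift_ratio (c : R) :
  (fun k => (k%:R + c) / k.+1%:R) @ \oo --> (1 : R).
Proof.
pose proof (cvgD (@cvgn_cst R 1)
  (cvgM (@cvgn_cst R (c - 1)) (@cvg_harmonic R))) as h.
rewrite mulr0 addr0 in h; apply: cvg_trans h; apply: near_eq_cvg; near=> k.
by rewrite fctE /= -natr1; field; rewrite natr1 pnatr_eq0.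
Unshelve. all: by end_near. Qed.

Lemma cvg_poch_ub M :
  (fun s => (ln (\prod_(k < s) poch_ub M k) - ln s`!%:R) / s%:R) @ \oo
    --> (0 : R).
Proof.
exact: (cvg_ln_prod (@poch_ub_gt0 M) (@cvg_shift_ratio _)).
Qed.

Lemma near_poch_lbE M : \forall k \near \oo,
  opnorm2 M < k%:R /\ poch_lb M k = k%:R - opnorm2 M.
Proof.
near=> k; have k1 : opnorm2 M + 1 <= k%:R by near: k; exact: nbhs_infty_ger.
split; first by rewrite (lt_le_trans _ k1)// ltrDl.
by apply/max_idPr; rewrite lerBrDl.
Unshelve. all: by end_near. Qed.

Lemma cvg_poch_lb M :
  (fun s => (ln (\prod_(k < s) poch_lb M k) - ln s`!%:R) / s%:R) @ \oo
    --> (0 : R).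
Proof.
apply: (cvg_ln_prod (@poch_lb_gt0 M)).
apply: cvg_trans (cvg_shift_ratio (- opnorm2 M)); apply: near_eq_cvg.
near=> k.
suff [_ ->] : opnorm2 M < k%:R /\ poch_lb M k = k%:R - opnorm2 M by [].
by near: k; exact: near_poch_lbE.
Unshelve. all: by end_near. Qed.

Lemma opnorm2_pochmx_le M s :
  opnorm2 (pochmx M s) <= \prod_(k < s) poch_ub M k.
Proof.
elim: s => [|s IH]; first by rewrite /pochmx !big_ord0 opnorm2_1.
rewrite pochmxS big_ord_recr/= (le_trans (opnorm2M _ _))//.
apply: ler_pM; rewrite ?opnorm2_ge0//.
by rewrite (le_trans (opnorm2_shift _ _))// addrC lerD2l lerDl.
Qed.

(** From some rank m on, M + s is invertible with an inverse of norm at most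
1 / (s - ||M||), so (M)_s = (M)_(s+1) (M + s)^-1 shows that the ratio of the
norm of (M)_s to the product of the lower bounds is nondecreasing.  It is
positive at m because (M)_m != 0. *)
Lemma opnorm2_pochmx_ge M : (forall s, pochmx M s != 0) ->
  exists2 c : R, 0 < c & \forall s \near \oo,
    c * \prod_(k < s) poch_lb M k <= opnorm2 (pochmx M s).
Proof.
move=> M0; have [m _ Mm] := near_poch_lbE M.
have l0 := prod_poch_lb_gt0 M.
exists (opnorm2 (pochmx M m) / \prod_(k < m) poch_lb M k).
  by rewrite divr_gt0 ?opnorm2_gt0.
exists m => //= s ms; rewrite -(subnKC ms).
elim: (s - m)%N => [|d IH]; first by rewrite addn0 divfK ?lexx ?lt0r_neq0 ?l0.
have [Md lE] := Mm _ (leq_addr d m).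
rewrite addnS big_ord_recr/= mulrA lE -ler_pdivlMr ?subr_gt0//.
apply: (le_trans IH).
rewrite -[pochmx M (m + d)](mulmxK (shift_unitmx Md)) -pochmxS.
apply: le_trans (opnorm2M _ _) _.
by rewrite ler_wpM2l ?opnorm2_ge0// opnorm2_inv_shift.
Qed.

(** The same induction, now on (M)_(s+1)^-1 = (M + s)^-1 (M)_s^-1. *)
Lemma opnorm2_inv_pochmx_le M : (1%:M : 'M[R[i]]_N) != 0 ->
  (forall k, M + k%:R%:M \in unitmx) ->
  exists2 c : R, 0 < c & \forall s \near \oo,
    opnorm2 (invmx (pochmx M s)) <= c / \prod_(k < s) poch_lb M k.
Proof.
move=> I0 Mu; have [m _ Mm] := near_poch_lbE M.
have l0 := prod_poch_lb_gt0 M.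
exists (opnorm2 (invmx (pochmx M m)) * \prod_(k < m) poch_lb M k).
  rewrite mulr_gt0// opnorm2_gt0//; apply: contra I0 => /eqP PV0.
  by rewrite -(mulmxV (pochmx_unitmx m Mu)) PV0 mulmx0.
exists m => //= s ms; rewrite -(subnKC ms).
elim: (s - m)%N => [|d IH]; first by rewrite addn0 mulfK ?lexx ?lt0r_neq0 ?l0.
have [Md lE] := Mm _ (leq_addr d m).
rewrite addnS invmx_pochmxS// big_ord_recr/= lE invfM mulrA [leRHS]mulrC.
apply: le_trans (opnorm2M _ _) _.
apply: ler_pM; [exact: opnorm2_ge0|exact: opnorm2_ge0| |exact: IH].
exact: opnorm2_inv_shift.
Qed.

Lemma cvg_ln_opnorm2_pochmx M : (forall s, pochmx M s != 0) ->
  (fun s => (ln (opnorm2 (pochmx M s)) - ln s`!%:R) / s%:R) @ \oo --> (0 : R).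
Proof.
move=> M0; have [c c0 cM] := opnorm2_pochmx_ge M0.
pose proof (cvgD (cvg_cst_div (ln c)) (cvg_poch_lb M)) as lb.
rewrite addr0 in lb.
apply: (squeeze_cvgr _ lb (cvg_poch_ub M)); near=> s; rewrite fctE /=.
have l0 := prod_poch_lb_gt0 M s.
have u0 : 0 < \prod_(k < s) poch_ub M k.
  by apply: prodr_gt0 => k _; exact: poch_ub_gt0.
rewrite -mulrDl !ler_wpM2r ?invr_ge0 ?ler0n//.
  by rewrite lerD2r ler_ln ?posrE ?opnorm2_gt0// opnorm2_pochmx_le.
rewrite addrA lerD2r -lnM ?posrE// ler_ln ?posrE ?mulr_gt0 ?opnorm2_gt0//.
by near: s.
Unshelve. all: by end_near. Qed.

(** The lower bound comes from 0 < ||1|| <= ||(M)_s|| ||(M)_s^-1||.  A nonzero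
identity matrix excludes the dimension 0, where all norms vanish. *)
Lemma cvg_ln_opnorm2_inv_pochmx M : (1%:M : 'M[R[i]]_N) != 0 ->
  (forall k, M + k%:R%:M \in unitmx) ->
  (fun s => (ln (opnorm2 (invmx (pochmx M s))) + ln s`!%:R) / s%:R) @ \oo
    --> (0 : R).
Proof.
move=> I0 Mu; have [c c0 cM] := opnorm2_inv_pochmx_le I0 Mu.
have PV s : pochmx M s *m invmx (pochmx M s) = 1%:M.
  by rewrite mulmxV// pochmx_unitmx.
have P0 s : pochmx M s != 0.
  by apply: contra I0 => /eqP P0; rewrite -(PV s) P0 mul0mx.
have PV0 s : invmx (pochmx M s) != 0.
  by apply: contra I0 => /eqP P0'; rewrite -(PV s) P0' mulmx0.
pose proof (cvgB (cvg_cst_div (ln (opnorm2 (1%:M : 'M[R[i]]_N))))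
  (cvg_ln_opnorm2_pochmx P0)) as lb.
pose proof (cvgB (cvg_cst_div (ln c)) (cvg_poch_lb M)) as ub.
rewrite subr0 in lb; rewrite subr0 in ub.
apply: (squeeze_cvgr _ lb ub); near=> s; rewrite fctE /=.
have l0 := prod_poch_lb_gt0 M s.
rewrite -!mulrBl.
apply/andP; split; apply: ler_wpM2r; rewrite ?invr_ge0 ?ler0n//.
  have shuffle (a b d f : R) : a <= b + d -> a - (b - f) <= d + f by lra.
  apply: shuffle.
  rewrite -lnM ?posrE ?opnorm2_gt0// ler_ln ?posrE ?mulr_gt0 ?opnorm2_gt0//.
  by rewrite -(PV s) opnorm2M.
have shuffle (a b d f : R) : a <= b - d -> a + f <= b - (d - f) by lra.
apply: shuffle.
rewrite -ln_div ?posrE// ler_ln ?posrE ?opnorm2_gt0 ?divr_gt0//.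
by near: s.
Unshelve. all: by end_near. Qed.

End PochhammerGrowth.

(** * Order, type and convergence from the growth of the coefficients *)

Section OrderAndType.
Set Implicit Arguments.
Unset Strict Implicit.
Variables (R : realType) (x : nat -> R) (p q : R).
Hypotheses (x_gt0 : forall s, 0 < x s) (p_gt0 : 0 < p).
Hypothesis x_growth : (fun s => ln (x s) / s%:R + p * ln s%:R) @ \oo --> q.

(** With v_s the sequence that tends to q, the quotient equals
(p - v_s / ln s)^-1. *)
Lemma cvg_order : (fun s => s%:R * ln s%:R / ln (x s)^-1) @ \oo --> p^-1.
Proof.
have lnV0 : (fun s => (ln s%:R)^-1 : R) @ \oo --> (0 : R).
  apply/gtr0_cvgV0; last exact: cvg_lnn_pinfty.
  by near=> s; rewrite ln_gt0// ltr1n; near: s; exact: nbhs_infty_gt.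
pose proof (cvgB (@cvgn_cst R p) (cvgM x_growth lnV0)) as h.
rewrite mulr0 subr0 in h.
pose proof (cvgV (lt0r_neq0 p_gt0) h) as h'.
apply: cvg_trans h'; apply: near_eq_cvg; near=> s.
rewrite !fctE.
have s1 : (1 < s)%N by near: s; exact: nbhs_infty_gt.
have s0 : s%:R != 0 :> R by rewrite pnatr_eq0 -lt0n (ltn_trans _ s1).
have ls0 : ln s%:R != 0 :> R by rewrite gt_eqF// ln_gt0// ltr1n.
rewrite lnV ?posrE//.
have -> : - ln (x s) = s%:R * ln s%:R *
    (p - (ln (x s) / s%:R + p * ln s%:R) * (ln s%:R)^-1).
  by field; rewrite s0 ls0.
by rewrite [in RHS]invfM mulrA divff ?mul1r// mulf_neq0.
Unshelve. all: by end_near. Qed.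

(** With v_s the sequence that tends to q, the left-hand side is
exp (v_s / p). *)
Lemma cvg_type : (fun s => s%:R * x s `^ (p^-1 / s%:R)) @ \oo --> expR (q / p).
Proof.
have h : (fun s => expR ((ln (x s) / s%:R + p * ln s%:R) / p)) @ \oo
    --> expR (q / p).
  apply: continuous_cvg; first exact: continuous_expR.
  by apply: cvgM => //; exact: cvgn_cst.
apply: cvg_trans h; apply: near_eq_cvg; near=> s.
have s0 : 0 < s%:R :> R by near: s; exact: nbhs_infty_gtr.
rewrite /powR gt_eqF// -[X in _ = X * _]lnK ?posrE// -expRD; congr expR.
by field; rewrite !gt_eqF.
Unshelve. all: by end_near. Qed.

(** The logarithm of (2 r)^s x_s is s times a quantity that tends to -oo, so
(2 r)^s x_s is bounded and the series is dominated by a geometric series of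
ratio 1/2. *)
Lemma is_cvg_series_growth (r : R) : 0 < r ->
  cvgn (series (fun s => r ^+ s * x s)).
Proof.
move=> r0; have r20 : 0 < 2 * r by rewrite mulr_gt0.
have y_ge0 s : 0 <= (2 * r) ^+ s * x s.
  by rewrite mulr_ge0 ?exprn_ge0// ltW.
(* The ratio 2 leaves room for a summable factor 2^-s. *)
have [m _ ym] : \forall s \near \oo, (2 * r) ^+ s * x s <= 1.
  near=> s; have s0 : 0 < s%:R :> R by near: s; exact: nbhs_infty_gtr.
  rewrite -ler_ln ?posrE ?mulr_gt0 ?exprn_gt0// ln1.
  rewrite lnM ?posrE ?exprn_gt0// lnXn// -[_ *+ s]mulr_natr.
  have -> : ln (2 * r) * s%:R + ln (x s) =
      s%:R * (ln (2 * r) + (ln (x s) / s%:R + p * ln s%:R) - p * ln s%:R).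
    by field; rewrite gt_eqF.
  rewrite pmulr_rle0// subr_le0 -[leRHS]mulrC -ler_pdivrMr//.
  apply: (@le_trans _ _ ((ln (2 * r) + (q + 1)) / p)).
    rewrite ler_pM2r ?invr_gt0// lerD2l.
    by near: s; apply: (cvgr_le _ x_growth); rewrite ltrDl.
  by near: s; move/cvgryPge: (@cvg_lnn_pinfty R); apply.
(* C dominates the tail, whose terms are at most 1, and the first m terms. *)
pose C := 1 + \sum_(k < m) (2 * r) ^+ k * x k.
have yC s : (2 * r) ^+ s * x s <= C.
  have [ms|sm] := leqP m s.
    by rewrite (le_trans (ym _ ms))// lerDl sumr_ge0.
  rewrite /C (bigD1 (Ordinal sm))//= addrCA lerDl.
  by rewrite addr_ge0// sumr_ge0.
have h2 : `|2^-1 : R| < 1 by rewrite ger0_norm ?invr_ge0// invf_lt1// ltr1n.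
apply: (@series_le_cvg _ _ (geometric C 2^-1)) => [s|s|s|].
- by rewrite mulr_ge0 ?exprn_ge0// ltW.
- by rewrite /= mulr_ge0 ?exprn_ge0 ?invr_ge0// (le_trans _ (yC 0%N)).
- rewrite /= exprVn ler_pdivlMr ?exprn_gt0//.
  by rewrite mulrC mulrA -exprMn yC.
- exact: is_cvg_geometric_series.
Unshelve. all: by end_near. Qed.

End OrderAndType.

(** * Convergence of matrix power series *)

Section MatrixConvergence.
Set Implicit Arguments.
Unset Strict Implicit.
Variables (R : realType) (N : nat).
Local Notation normc := (@Normc.normc R).

Lemma cvg_complex_ReIm (f : nat -> R[i]) (a : R[i]) :
  (fun n => complex.Re (f n)) @ \oo --> complex.Re a ->
  (fun n => complex.Im (f n)) @ \oo --> complex.Im a ->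
  (f : nat -> (R[i]^o)%type) @ \oo --> (a : (R[i]^o)%type).
Proof.
move=> /cvgrPdist_lt fRe /cvgrPdist_lt fIm; apply/cvgrPdist_lt => -[e e'].
rewrite ltcE/= => /andP[/eqP-> e0]; have e2 : 0 < e / 2 by rewrite divr_gt0.
near=> n.
have hR : `|complex.Re a - complex.Re (f n)| < e / 2.
  by near: n; exact: fRe.
have hI : `|complex.Im a - complex.Im (f n)| < e / 2.
  by near: n; exact: fIm.
rewrite normc_def -[ltRHS]/(e%:C) ltcR.
have -> : complex.Re (a - f n) = complex.Re a - complex.Re (f n).
  by case: (a) => ? ?; case: (f n).
have -> : complex.Im (a - f n) = complex.Im a - complex.Im (f n).
  by case: (a) => ? ?; case: (f n).
move: (complex.Re a - _) (complex.Im a - _) hR hI => u v hu hv.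
rewrite [ltRHS]splitr; apply: le_lt_trans (ltrD hu hv).
rewrite -(ler_pXn2r (_ : (0 < 2)%N)) ?nnegrE ?sqrtr_ge0 ?addr_ge0//.
rewrite sqr_sqrtr ?addr_ge0 ?sqr_ge0// sqrrD !real_normK ?num_real//.
by rewrite lerD2r lerDl mulrn_wge0// mulr_ge0.
Unshelve. all: by end_near. Qed.

Lemma cvg_mx_entries (F : nat -> Cmx R N) (L : Cmx R N) :
  (forall i j, (fun n => F n i j) @ \oo --> L i j) -> F @ \oo --> L.
Proof.
move=> FL A [P LP PA].
have FP : \forall n \near \oo, forall i j, P i j (F n i j).
  by apply: filter_forall => i; apply: filter_forall => j;
    exact: (FL i j _ (LP i j)).
by apply: filterS FP => n; exact: PA.
Qed.

(** Entries are bounded by the operator norm, so the real and imaginary parts of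
each entry form absolutely convergent real series.  Working with these parts
reduces the statement to the completeness of the reals. *)
Lemma is_cvg_mxpowser (U : nat -> 'M[R[i]]_N) (z : R[i]) (r : R) :
  normc z <= r -> cvgn (series (fun s => r ^+ s * opnorm2 (U s))) ->
  cvgn (mxpowser U z).
Proof.
move=> zr sU.
have entry_le i j s : normc ((z ^+ s *: U s) i j) <= r ^+ s * opnorm2 (U s).
  rewrite mxE Normc.normcM normcX ler_pM ?exprn_ge0 ?normc_ge0//.
    by rewrite lerXn2r ?nnegrE ?(le_trans _ zr) ?normc_ge0.
  exact: normc_le_opnorm2.
have dom (g : nat -> R) : (forall s, `|g s| <= r ^+ s * opnorm2 (U s)) ->
    cvgn (series g).
  move=> gU; apply: normed_cvg; apply: series_le_cvg sU => // s /=.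
    exact: normr_ge0.
  exact: (le_trans (normr_ge0 (g s)) (gU s)).
have cRe i j : cvgn (series (fun s => complex.Re ((z ^+ s *: U s) i j))).
  apply: dom => s; apply: le_trans (entry_le i j s).
  by rewrite -lecR; exact: normc_ge_Re.
have cIm i j : cvgn (series (fun s => complex.Im ((z ^+ s *: U s) i j))).
  apply: dom => s; apply: le_trans (entry_le i j s).
  case: (_ i j) => u v /=; rewrite -[leLHS]sqrtr_sqr ler_sqrt.
    by rewrite lerDr sqr_ge0.
  by rewrite addr_ge0 ?sqr_ge0.
pose L : Cmx R N := \matrix_(i, j)
  (limn (series (fun s => complex.Re ((z ^+ s *: U s) i j))) +i*
   limn (series (fun s => complex.Im ((z ^+ s *: U s) i j)))).
have sumRe i j n : complex.Re (mxpowser U z n i j) =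
    series (fun s => complex.Re ((z ^+ s *: U s) i j)) n.
  rewrite /mxpowser /series/= summxE.
  elim/big_ind2: _ => // -[? ?] ? [? ?] ? /=.
  by move=> <- <-.
have sumIm i j n : complex.Im (mxpowser U z n i j) =
    series (fun s => complex.Im ((z ^+ s *: U s) i j)) n.
  rewrite /mxpowser /series/= summxE.
  elim/big_ind2: _ => // -[? ?] ? [? ?] ? /=.
  by move=> <- <-.
apply: (cvgP L); apply: cvg_mx_entries => i j; apply: cvg_complex_ReIm.
- by under eq_cvg do rewrite sumRe; rewrite mxE; exact: cRe.
- by under eq_cvg do rewrite sumIm; rewrite mxE; exact: cIm.
Qed.

End MatrixConvergence.

(** * Growth of the hypergeometric coefficients *)

Section CoefficientGrowth.
Set Implicit Arguments.
Unset Strict Implicit.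
Variables (R : realType) (N : nat) (A B C : 'M[R[i]]_N).
Hypotheses (A0 : forall s, pochmx A s != 0)
  (hB : forall k : nat, B + k%:R%:M \in unitmx)
  (hC : forall k : nat, C + k%:R%:M \in unitmx).
Local Notation normc := (@Normc.normc R).
Local Notation U := (coef1F2 A B C).

Let fact_gt0R s : 0 < s`!%:R :> R.
Proof. by rewrite ltr0n fact_gt0. Qed.

Let I0 : (1%:M : 'M[R[i]]_N) != 0.
Proof. by have := A0 0; rewrite /pochmx big_ord0. Qed.

(** The definition of U_s solved for (A)_s; it yields the lower bound on the
norm of U_s, and shows that U_s is not zero. *)
Lemma pochmx_coef1F2 s :
  pochmx A s = s`!%:R *: (U s *m pochmx C s *m pochmx B s).
Proof.
have f0 : s`!%:R != 0 :> R[i] by rewrite pnatr_eq0 -lt0n fact_gt0.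
rewrite /coef1F2 -!scalemxAl scalerA divff// scale1r.
by rewrite !mulmxKV ?pochmx_unitmx.
Qed.

Lemma coef1F2_neq0 s : U s != 0.
Proof.
apply: contra (A0 s) => /eqP U0.
by rewrite pochmx_coef1F2 U0 !mul0mx scaler0.
Qed.

Lemma opnorm2_coef1F2_le s : opnorm2 (U s) <= s`!%:R^-1 *
  (opnorm2 (pochmx A s) * opnorm2 (invmx (pochmx B s))
    * opnorm2 (invmx (pochmx C s))).
Proof.
rewrite /coef1F2 (le_trans (opnorm2Z _ _))// Normc.normcV normc_nat.
rewrite ler_wpM2l ?invr_ge0 ?ler0n// (le_trans (opnorm2M _ _))//.
by rewrite ler_wpM2r ?opnorm2_ge0// opnorm2M.
Qed.

Lemma opnorm2_pochmx_le_coef1F2 s : opnorm2 (pochmx A s) <= s`!%:R *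
  (opnorm2 (U s) * opnorm2 (pochmx C s) * opnorm2 (pochmx B s)).
Proof.
rewrite {1}pochmx_coef1F2 (le_trans (opnorm2Z _ _))// normc_nat.
rewrite ler_wpM2l ?ler0n// (le_trans (opnorm2M _ _))//.
by rewrite ler_wpM2r ?opnorm2_ge0// opnorm2M.
Qed.

Lemma cvg_ln_opnorm2_coef1F2 :
  (fun s => ln (opnorm2 (U s)) / s%:R + 2 * ln s%:R) @ \oo --> (2 : R).
Proof.
have unit0 P : P \in unitmx -> P != 0 :> 'M[R[i]]_N.
  by move=> uP; apply: contra I0 => /eqP P0; rewrite -(mulmxV uP) P0 mul0mx.
have inv0 P : P \in unitmx -> invmx P != 0 :> 'M[R[i]]_N.
  by move=> uP; apply: unit0; rewrite unitmx_inv.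
have uB s := pochmx_unitmx s hB; have uC s := pochmx_unitmx s hC.
pose proof (cvg_ln_opnorm2_pochmx A0) as gA.
pose proof (cvg_ln_opnorm2_pochmx (fun s => unit0 _ (uB s))) as gB.
pose proof (cvg_ln_opnorm2_pochmx (fun s => unit0 _ (uC s))) as gC.
pose proof (cvg_ln_opnorm2_inv_pochmx I0 hB) as gB'.
pose proof (cvg_ln_opnorm2_inv_pochmx I0 hC) as gC'.
have pos P : P != 0 :> 'M[R[i]]_N -> opnorm2 P \is Num.pos.
  by rewrite posrE; exact: opnorm2_gt0.
have fpos s : s`!%:R \is @Num.pos R by rewrite posrE fact_gt0R.
have fVpos s : s`!%:R^-1 \is @Num.pos R by rewrite posrE invr_gt0 fact_gt0R.
have mpos (x y : R) : x \is Num.pos -> y \is Num.pos -> x * y \is Num.pos.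
  by rewrite !posrE; exact: mulr_gt0.
have pU s := pos _ (coef1F2_neq0 s).
have pA s := pos _ (A0 s).
have pB s := pos _ (unit0 _ (uB s)).
have pC s := pos _ (unit0 _ (uC s)).
have pB' s := pos _ (inv0 _ (uB s)).
have pC' s := pos _ (inv0 _ (uC s)).
apply: (cvg_growth_squeeze gA gB gC gB' gC') => s.
- have := opnorm2_pochmx_le_coef1F2 s.
  by rewrite -ler_ln; [rewrite !lnM|..]; auto 6.
- have := opnorm2_coef1F2_le s.
  by rewrite -ler_ln; [rewrite !lnM ?lnV|..]; auto 6.
Qed.

End CoefficientGrowth.

Theorem theorem2p3 (R : realType) (N : nat) (A B C : 'M[R[i]]_N)
    (hAB : comm_mx A B) (hAC : comm_mx A C) (hBC : comm_mx B C)
    (hB : forall s : nat, B + s%:R%:M \in unitmx)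
    (hC : forall s : nat, C + s%:R%:M \in unitmx)
    (hA : forall s : nat, pochmx A s != 0) :
  entire_expansion (hyp1F2 A B C) (coef1F2 A B C) /\
  has_entire_type (coef1F2 A B C) 2%:E.
Proof.
have U0 s := opnorm2_gt0 (coef1F2_neq0 hA hB hC s).
have growth := cvg_ln_opnorm2_coef1F2 hA hB hC.
have p0 : 0 < 2 :> R by [].
split.
  move=> z; have r0 : 0 < Normc.normc z + 1 by rewrite ltr_wpDl ?normc_ge0.
  apply: is_cvg_mxpowser (is_cvg_series_growth U0 p0 growth r0).
  by rewrite lerDl.
have limsup_EFin (u : nat -> R) (l : R) : u @ \oo --> l ->
    limn_esup (fun s => (u s)%:E) = l%:E.
  move=> ul.
  suff /cvg_limn_einf_sup[] : (fun s => (u s)%:E) @ \oo --> l%:E by [].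
  by apply/fine_cvgP; split; [exact: nearW|exact: ul].
exists 2^-1; split; rewrite ?invr_gt0//.
  exact: limsup_EFin (cvg_order U0 p0 growth).
rewrite (limsup_EFin _ _ (cvg_type U0 p0 growth)) divff// -EFinM.
by congr EFin; field; rewrite gt_eqF ?expR_gt0.
Qed.
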